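(* Let $(F_1,\|\cdot\|_1)$ be a normed space of integrable univariate functions over a Borel set $D_1\subseteq\mathbb{R}$ and, for $d\in\mathbb{N}$, let $(F_d,\|\cdot\|_d)$ be the $d$-fold tensor product space equipped with a crossnorm $\|\cdot\|_d$. Assume that in $F_1$ there exists a worst-case function $h_1$ (with $h_d(x_1,\dots,x_d)=\prod_{j=1}^dh_1(x_j)$ a worst-case function in $F_d$ for every $d$). Assume that for every $y\in D_1$ there exists a function $s_y\in F_1$ such that $s_y\ge0$, $s_y(y)=h_1(y)$, and $$\alpha:=\max_{y\in D_1}\|s_y\|_1<\|h_1\|_1\quad\text{and}\quad\beta:=\max_{y\in D_1}I_1(s_y)<I_1(h_1).$$ Put $$\widetilde C:=\min\left(\frac{\|h_1\|_1}{\alpha},\frac{I_1(h_1)}{\beta}\right).$$ Then $\widetilde C>1$ and $$N^+(\varepsilon,d)\ge\widetilde C^d(1-2\varepsilon)\quad\text{for all }\varepsilon\in\left(0,\tfrac12\right)\text{ and }d\in\mathbb{N}.$$ In particular, the integration problem in $F_d$ suffers from the curse of dimensionality for positive quadrature formulas.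
   Context: Notation: $\mathbb{N}=\{1,2,\dots\}$. A quotient with positive numerator and denominator $0$ is read as $+\infty$. Setting: $D_d=D_1\times\dots\times D_1$ ($d$-fold). $F_d=F_1\otimes\dots\otimes F_1$ ($d$-fold) is a tensor product space of integrable functions on $D_d$ (containing all elementary tensors $f(x_1,\dots,x_d)=f_1(x_1)\cdots f_d(x_d)$, $f_j\in F_1$), with a norm $\|\cdot\|_d$ that is a crossnorm, i.e. $\|f\|_d=\|f_1\|_1\cdots\|f_d\|_1$ for elementary tensors. $F_d$ is not claimed to be uniquely determined by these requirements. Integration: $I_d(f)=\int_{D_d}f(\boldsymbol{x})\,\mathrm{d}\boldsymbol{x}$. Initial error: $e(0,d)=\sup\{|I_d(f)|: f\in F_d,\ \|f\|_d\le1\}$. A positive linear algorithm (positive quadrature formula) is $A_{d,N}^+(f)=\sum_{k=1}^Na_kf(\boldsymbol{x}_k)$ with nodes $\boldsymbol{x}_k\in D_d$ and weights $a_k\ge0$; its worst-case error is $e(F_d,A_{d,N}^+)=\sup\{|I_d(f)-A_{d,N}^+(f)|: f\in F_d,\ \|f\|_d\le1\}$. $e^+(N,d)$ is the infimum of $e(F_d,A_{d,N}^+)$ over all positive linear algorithms using $N$ nodes, and $N^+(\varepsilon,d)=\min\{N\in\mathbb{N}: e^+(N,d)\le\varepsilon\,e(0,d)\}$ ($=\infty$ if no such $N$ exists). Curse of dimensionality for positive quadrature formulas: for some fixed $\varepsilon>0$, $N^+(\varepsilon,d)$ grows at least exponentially fast in $d$. Worst-case function: $h_1\in F_1$ with $e(0,1)=I_1(h_1/\|h_1\|_1)$.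 Standing assumption: for every $d$ the tensor product $h_d(\boldsymbol{x})=\prod_{j=1}^dh_1(x_j)$ is a worst-case function in $F_d$, i.e. $e(0,d)=I_d(h_d/\|h_d\|_d)$, hence $e(0,d)=e(0,1)^d$. *)

(* Defs.v *)
From HB Require Import structures.
From mathcomp Require Import all_boot all_order all_algebra.
From mathcomp Require Import all_classical all_reals all_analysis.
From mathcomp Require Import measurable_realfun.
Set Implicit Arguments.
Unset Strict Implicit.
Unset Printing Implicit Defensive.
Import Order.TTheory GRing.Theory Num.Theory.
Import numFieldNormedType.Exports.
Local Open Scope classical_set_scope.
Local Open Scope ring_scope.

Section lebesgue_tuple.
Context (R : realType).

Local Notation RT := (measurableTypeR R).

Definition tuple_cons n (p : RT * n.-tuple RT) : n.+1.-tuple RT :=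
  [tuple of p.1 :: p.2].

Lemma measurable_tuple_cons n : measurable_fun setT (@tuple_cons n).
Proof. exact: measurable_cons. Qed.

Section lebesgue_cons.
Context n (mu : {sigma_finite_measure set (n.-tuple RT) -> \bar R}).

Definition lebesgue_cons : set (n.+1.-tuple RT) -> \bar R :=
  pushforward (lebesgue_measure \x mu)%E (@tuple_cons n).

Let preimage_measurable A : measurable A -> measurable (@tuple_cons n @^-1` A).
Proof.
by move=> mA; rewrite -[X in measurable X]setTI; exact: measurable_tuple_cons.
Qed.

Let lebesgue_cons0 : lebesgue_cons set0 = 0%E.
Proof. by rewrite /lebesgue_cons /pushforward preimage_set0 measure0. Qed.

Let lebesgue_cons_ge0 A : (0 <= lebesgue_cons A)%E.
Proof. by rewrite /lebesgue_cons /pushforward measure_ge0. Qed.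

Let lebesgue_cons_sigma_additive : semi_sigma_additive lebesgue_cons.
Proof.
move=> F mF tF mUF; rewrite /lebesgue_cons /pushforward preimage_bigcup.
apply: measure_semi_sigma_additive.
- by move=> k; exact: preimage_measurable.
- apply/trivIsetP => /= i j _ _ ij; rewrite -preimage_setI.
  by move/trivIsetP : tF => /(_ _ _ _ _ ij) ->//; rewrite preimage_set0.
- by rewrite -preimage_bigcup; exact: preimage_measurable.
Qed.

HB.instance Definition _ := isMeasure.Build _ _ _ lebesgue_cons
  lebesgue_cons0 lebesgue_cons_ge0 lebesgue_cons_sigma_additive.

Let lebesgue_cons_sigma_finite : sigma_finite setT lebesgue_cons.
Proof.
have /sigma_finiteP[F [TF ndF Foo]] := sigma_finiteT (@lebesgue_measure R).
have /sigma_finiteP[G [TG ndG Goo]] := sigma_finiteT mu.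
pose uncons (t : n.+1.-tuple RT) : RT * n.-tuple RT :=
  (thead t, [tuple of behead t]).
have consK : cancel (@tuple_cons n) uncons.
  by move=> [x t]; congr pair; apply/val_inj.
exists (fun k => uncons @^-1` (F k `*` G k)).
  apply/seteqP; split=> // t _.
  have [i _ Fi] : (\bigcup_i F i) (thead t) by rewrite -TF.
  have [j _ Gj] : (\bigcup_i G i) [tuple of behead t] by rewrite -TG.
  exists (maxn i j) => //; split => /=.
    by move: Fi; exact/subsetPset/ndF/leq_maxl.
  by move: Gj; exact/subsetPset/ndG/leq_maxr.
move=> k; have [mF Fk] := Foo k; have [mG Gk] := Goo k; split.
  rewrite -[X in measurable X]setTI.
  have : measurable_fun setT uncons.
    apply/measurable_fun_pairP; split; first exact: measurable_tnth.
    exact: measurable_behead.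
  by apply => //; exact: measurableX.
rewrite /lebesgue_cons /pushforward -comp_preimage.
have -> : uncons \o @tuple_cons n = id by apply/funext.
rewrite preimage_id.
by rewrite product_measure1E// lte_mul_pinfty// ge0_fin_numE.
Qed.

HB.instance Definition _ := Measure_isSigmaFinite.Build _ _ _ lebesgue_cons
  lebesgue_cons_sigma_finite.

End lebesgue_cons.

Fixpoint lebesgue_tuple n : {sigma_finite_measure set (n.-tuple RT) -> \bar R} :=
  match n with
  | 0 => \d_[tuple]
  | m.+1 => lebesgue_cons (lebesgue_tuple m)
  end.

Lemma lebesgue_tuple_box n (A : 'I_n -> set RT) :
  (forall i, measurable (A i)) ->
  lebesgue_tuple n [set x | forall i, A i (tnth x i)] =
  (\prod_(i < n) lebesgue_measure (A i))%E.
Proof.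
elim: n A => [|n ih] A mA.
  by rewrite big_ord0 /= diracE mem_set// => -[].
rewrite big_ord_recl /= -ih// {1}/lebesgue_cons /pushforward.
rewrite -product_measure1E//; last first.
  rewrite (_ : [set _ | _] = \bigcap_(i in [set: 'I_n])
      ((fun x : n.-tuple RT => tnth x i) @^-1` A (lift ord0 i))); last first.
    by apply/seteqP; split=> x /= + i => /(_ i); [|exact].
  apply: fin_bigcap_measurable => // i _.
  rewrite -[X in measurable X]setTI.
  by apply: measurable_tnth.
congr (_ _); apply/seteqP; split=> -[x t] /=.
  move=> h; split; first exact: (h ord0).
  by move=> i; have := h (lift ord0 i); rewrite tnthS.
move=> [h0 h] i; case: (unliftP ord0 i) => [j|] ->//.
by rewrite tnthS; exact: h.
Qed.

Definition cube n (D : set RT) : set (n.-tuple RT) :=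
  [set x | forall i, D (tnth x i)].

End lebesgue_tuple.

Section lebesgue_integrable_on.
Context d (T : measurableType d) (R : realType).
Context (mu : {measure set T -> \bar R}) (D : set T).

(* [mu.-integrable] requires measurability for the sigma-algebra of [T]; going
   through an almost everywhere equal function amounts to completing [mu], so
   that Lebesgue-measurable functions are not excluded. *)
Definition lebesgue_integrable_on (f : T -> R) :=
  exists2 g : T -> R, mu.-integrable D (EFin \o g) &
    {ae mu, forall x, D x -> f x = g x}.

End lebesgue_integrable_on.

(* [\int[mu]_(x in D) f x] is a difference of suprema of integrals of simple
   functions and thus makes sense for any [f]; here is why it is the expected
   value when [f] is integrable in the above sense. *)
Section integral_ae_eq.
Local Open Scope ereal_scope.
Context d (T : measurableType d) (R : realType).
Variable mu : {measure set T -> \bar R}.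
Import HBNNSimple.

Let ge0_le_integral_ae (f g : T -> \bar R) :
  (forall x, 0 <= f x) -> (forall x, 0 <= g x) -> {ae mu, forall x, f x = g x} ->
  \int[mu]_x f x <= \int[mu]_x g x.
Proof.
move=> f0 g0 [N [mN N0 fgN]].
rewrite [leLHS]ge0_integralTE//; apply: ge_ereal_sup => _ [h /= hf <-].
rewrite -integralT_nnsfun.
have -> : \int[mu]_x (h x)%:E =
    \int[mu]_x (proj_nnsfun h (measurableC mN) x)%:E.
  apply: ae_eq_integral => //.
  - exact/measurable_EFinP.
  - exact/measurable_EFinP.
  exists N; split => // x /= hx; apply: contrapT => Nx; apply: hx => _ /=.
  by rewrite mindicE mem_set ?mulr1.
rewrite integralT_nnsfun [leRHS]ge0_integralTE//.
apply: ereal_sup_ubound; eexists; [|reflexivity] => x /=.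
rewrite mindicE; have [|] := boolP (x \in ~` N).
  rewrite inE => Nx; rewrite mulr1; have -> : g x = f x; last exact: hf.
  by apply/esym; apply: contrapT => fg; apply: Nx; exact: fgN.
by move=> _; rewrite mulr0.
Qed.

Lemma Rintegral_ae_eq (D : set T) (f g : T -> R) :
  {ae mu, forall x, D x -> f x = g x} ->
  (\int[mu]_(x in D) f x = \int[mu]_(x in D) g x)%R.
Proof.
move=> fg; rewrite /Rintegral; congr fine.
rewrite [LHS]integral_mkcond [RHS]integral_mkcond integralE [RHS]integralE.
have H (u v : T -> \bar R) : {ae mu, forall x, u x = v x} ->
    (forall x, 0 <= u x) -> (forall x, 0 <= v x) ->
    \int[mu]_x u x = \int[mu]_x v x.
  move=> uv u0 v0; apply/eqP; rewrite eq_le !ge0_le_integral_ae//.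
  by apply: filterS uv => x.
have fg' : {ae mu, forall x, ((EFin \o f) \_ D) x = ((EFin \o g) \_ D) x}.
  apply: filterS fg => x fg; rewrite /patch; case: ifPn => //.
  by rewrite inE => /fg /= ->.
by congr (_ - _); apply: H => //; apply: filterS fg' => x;
  rewrite ?funeposE ?funenegE => ->.
Qed.

End integral_ae_eq.

(* A normed space of integrable functions on [D]. An element [f] is the function
   [fun_of f] restricted to [D]; the values of [fun_of f] outside [D] are
   meaningless. *)
Record integrable_space d (T : measurableType d) (R : realType)
    (mu : {measure set T -> \bar R}) (D : set T) := IntegrableSpace {
  carrier :> normedModType R ;
  fun_of : carrier -> T -> R ;
  fun_of_linear : forall (a : R) (f g : carrier) x, D x ->
    fun_of (a *: f + g) x = a * fun_of f x + fun_of g x ;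
  fun_of_inj : forall f g : carrier,
    (forall x, D x -> fun_of f x = fun_of g x) -> f = g ;
  fun_of_integrable : forall f : carrier, lebesgue_integrable_on mu D (fun_of f)
}.
Arguments fun_of {d T R mu D i} f x.

Section integration_problem.
Context d (T : measurableType d) (R : realType).
Context (mu : {measure set T -> \bar R}) (D : set T).
Variable F : integrable_space mu D.

Definition integ (f : F) : R := \int[mu]_(x in D) fun_of f x.

Definition unit_ball : set F := [set f | `|f| <= 1].

Definition initial_error : \bar R :=
  ereal_sup [set `|integ f|%:E | f in unit_ball].

Definition is_worst_case (h : F) : Prop :=
  initial_error = (integ (`|h|^-1 *: h))%:E.

Definition quadrature N (a : 'I_N -> R) (x : 'I_N -> T) (f : F) : R :=
  \sum_(k < N) a k * fun_of f (x k).

Definition worst_case_error N (a : 'I_N -> R) (x : 'I_N -> T) : \bar R :=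
  ereal_sup [set `|integ f - quadrature a x f|%:E | f in unit_ball].

Definition min_error_pos (N : nat) : \bar R :=
  ereal_inf [set e | exists (a : 'I_N -> R) (x : 'I_N -> T),
    [/\ forall k, 0 <= a k, forall k, D (x k) & e = worst_case_error a x]].

(* The infimum of a nonempty set of natural numbers is its minimum, and the
   infimum of the empty set is [+oo]. *)
Definition complexity_pos (eps : R) : \bar R :=
  ereal_inf [set N%:R%:E | N in [set N : nat |
    (0 < N)%N /\ (min_error_pos N <= eps%:E * initial_error)%E]].

End integration_problem.

Section tensor_power.
Context (R : realType) (D1 : set (measurableTypeR R)).
Variables (F1 : integrable_space (@lebesgue_measure R) D1) (n : nat).
Variable Fn : integrable_space (@lebesgue_tuple R n) (cube (n := n) D1).

Definition is_elementary_tensor (f : 'I_n -> F1) (g : Fn) : Prop :=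
  forall x, cube D1 x -> fun_of g x = \prod_(j < n) fun_of (f j) (tnth x j).

(* The n-fold tensor product space is not determined by [F1]: it is only
   required to contain the elementary tensors, to carry a crossnorm, and to be
   [F1] itself when [n = 1]. *)
Definition is_tensor_power : Prop :=
  (forall f : 'I_n -> F1, exists2 g : Fn,
     is_elementary_tensor f g & `|g| = \prod_(j < n) `|f j|) /\
  (n = 1%N -> forall g : Fn, exists f : 'I_n -> F1, is_elementary_tensor f g).

End tensor_power.

Definition is_maximum (R : realType) (A : set R) (m : R) : Prop :=
  A m /\ ubound A m.

Definition curse_of_dimensionality (R : realType) (N : R -> nat -> \bar R) : Prop :=
  exists2 eps : R, 0 < eps & exists c C : R, [/\ 0 < c, 1 < C &
    forall d, (0 < d)%N -> ((c * C ^+ d)%:E <= N eps d)%E].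

(* Main.v *)
Require Import Defs.
From HB Require Import structures.
From mathcomp Require Import all_boot all_order all_algebra.
From mathcomp Require Import all_classical all_reals all_analysis.
From mathcomp Require Import measurable_realfun lra.
Set Implicit Arguments.
Unset Strict Implicit.
Unset Printing Implicit Defensive.
Import Order.TTheory GRing.Theory Num.Theory.
Import numFieldNormedType.Exports.
Local Open Scope classical_set_scope.
Local Open Scope ring_scope.

(* For nodes x_1, ..., x_N, let s_k be the tensor product of the functions
   s_{x_{k,1}}, ..., s_{x_{k,d}}. Since s_k >= 0, s_k(x_k) = h_d(x_k) and the
   weights are nonnegative, the quadrature Q satisfies
     Q(h_d) = sum_k a_k s_k(x_k) <= sum_k Q(s_k).
   If e is the worst-case error of Q, the left-hand side is at least
   I_d(h_d) - e |h_d|, and each summand on the right is at most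
   I_d(s_k) + e |s_k| <= beta^d + e alpha^d. Comparing the two for e a multiple
   of I_d(h_d) / |h_d| gives the lower bound on N. *)

(** * Integrals of separated products over product measures *)

(** By Tonelli: the iterated integral of the absolute value factors into the integrals of [|f|] and
    [|g|], both finite. *)
Lemma integrable_mul_prod d1 d2 (T1 : measurableType d1)
    (T2 : measurableType d2) (R : realType)
    (m1 : {sigma_finite_measure set T1 -> \bar R})
    (m2 : {sigma_finite_measure set T2 -> \bar R}) (f : T1 -> R) (g : T2 -> R) :
  m1.-integrable setT (EFin \o f) -> m2.-integrable setT (EFin \o g) ->
  (m1 \x m2)%E.-integrable setT (fun z => (f z.1 * g z.2)%:E).
Proof.
move=> /integrableP[mf If] /integrableP[mg Ig].
apply/integrable12ltyP.
  apply/measurable_EFinP; apply: measurable_funM.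
    by apply: (measurableT_comp (f := f)) => //; exact/measurable_EFinP.
  by apply: (measurableT_comp (f := g)) => //; exact/measurable_EFinP.
have mabs d (T : measurableType d) (h : T -> R) :
    measurable_fun setT (EFin \o h) -> measurable_fun setT (fun x => `|h x|%:E).
  move=> /measurable_EFinP mh.
  by apply/measurable_EFinP/measurableT_comp.
pose c := fine (\int[m2]_y `|(EFin \o g) y|)%E.
have cE : (\int[m2]_y `|(EFin \o g) y| = c%:E)%E.
  by rewrite fineK// ge0_fin_numE// integral_ge0.
under eq_integral => x _.
  under eq_integral do rewrite /= normrM EFinM.
  rewrite ge0_integralZl//=; last exact: mabs.
  rewrite -[X in (_ * X)%E]/(\int[m2]_y `|(EFin \o g) y|)%E cE muleC.
  over.
have c0 : 0 <= c by rewrite fine_ge0//; apply: integral_ge0.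
rewrite ge0_integralZl//=; last exact: mabs.
by rewrite lte_mul_pinfty.
Qed.

Lemma Rintegral_mul_prod d1 d2 (T1 : measurableType d1)
    (T2 : measurableType d2) (R : realType)
    (m1 : {sigma_finite_measure set T1 -> \bar R})
    (m2 : {sigma_finite_measure set T2 -> \bar R}) (f : T1 -> R) (g : T2 -> R) :
  m1.-integrable setT (EFin \o f) -> m2.-integrable setT (EFin \o g) ->
  \int[(m1 \x m2)%E]_z (f z.1 * g z.2) = (\int[m1]_x f x) * (\int[m2]_y g y).
Proof.
move=> fi gi; rewrite {1}/Rintegral.
rewrite -integral12_prod_meas1; last exact: integrable_mul_prod.
rewrite [X in fine X](_ : _ = \int[m1]_x (f x * \int[m2]_y g y)%:E)%E.
  by rewrite -/(Rintegral _ _ _) RintegralZr.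
apply: eq_integral => x _; rewrite /fubini_F /= -RintegralZl//.
rewrite /Rintegral fineK//; apply: integrable_fin_num => //.
under eq_fun do rewrite EFinM.
exact: integrableZl.
Qed.

(** * Fubini and null sets for Lebesgue measure on tuples *)

Section lebesgue_tensor.
Context (R : realType).
Local Notation RT := (measurableTypeR R).
Local Notation lambda := (@lebesgue_measure R).

(** Induction on [n]: the measure on [n.+1]-tuples is the pushforward under [tuple_cons] of a binary
    product, to which the two-factor case applies. Integrability is carried along because Fubini
    needs it for the tail at the next step. *)
Lemma lebesgue_tuple_tensor n (f : 'I_n -> RT -> R) :
  (forall i, lambda.-integrable setT (EFin \o f i)) ->
  (lebesgue_tuple R n).-integrable setT
    (fun x => (\prod_(i < n) f i (tnth x i))%:E) /\
  \int[lebesgue_tuple R n]_x (\prod_(i < n) f i (tnth x i)) =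
    \prod_(i < n) \int[lambda]_x f i x.
Proof.
elim: n f => [|n ih] f fi.
  under [X in _.-integrable _ X]eq_fun do rewrite big_ord0.
  under eq_Rintegral do rewrite big_ord0.
  rewrite big_ord0 /=; split.
    exact: (finite_measure_integrable_cst (\d_([tuple] : 0.-tuple RT))).
  by rewrite /Rintegral integral_dirac// diracT mul1e.
have [gi gE] := ih (fun i => f (lift ord0 i)) (fun i => fi (lift ord0 i)).
pose F (x : n.+1.-tuple RT) := (\prod_(i < n.+1) f i (tnth x i))%:E.
have mf i : measurable_fun setT (f i).
  by apply/measurable_EFinP; case/integrableP : (fi i).
have mF : measurable_fun setT F.
  apply/measurable_EFinP; apply: measurable_prod => i _.
  by apply: measurableT_comp => //; exact: measurable_tnth.
have FE : F \o @tuple_cons R n = fun z => (f ord0 z.1 *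
    \prod_(i < n) f (lift ord0 i) (tnth z.2 i))%:E.
  apply/funext => -[x t]; rewrite /F /= big_ord_recl; congr (_ * _)%:E.
  by apply: eq_bigr => i _; rewrite tnthS.
have Fi := integrable_mul_prod (fi ord0) gi.
split.
  apply: (@integrable_pushforward _ _ _ _ _ (@tuple_cons R n) _
    (lambda \x lebesgue_tuple R n)%E setT) => //.
  - exact: measurable_tuple_cons.
  - by rewrite FE.
rewrite big_ord_recl -gE -(Rintegral_mul_prod (fi ord0) gi) /Rintegral.
rewrite (@integral_pushforward _ _ _ _ _ (@tuple_cons R n) _
  (lambda \x lebesgue_tuple R n)%E setT F) ?FE//.
exact: measurable_tuple_cons.
Qed.

(** The exceptional set of coordinate [i] lies in a box with a null side [N] in direction [i] and
    the whole line elsewhere. Since 0 times infinity is 0 in [\bar R], this box is null; finitely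
    many coordinates are then combined. *)
Lemma lebesgue_tuple_ae n (P : 'I_n -> set RT) :
  (forall i, {ae lambda, forall x, P i x}) ->
  {ae lebesgue_tuple R n, forall x, forall i, P i (tnth x i)}.
Proof.
move=> aeP; have aeT i : {ae lebesgue_tuple R n, forall x, P i (tnth x i)}.
  have [N [mN N0 PN]] := aeP i.
  pose A j := if j == i then N else setT.
  exists [set x | forall j, A j (tnth x j)]; split.
  - rewrite (_ : [set _ | _] = (fun x : n.-tuple RT => tnth x i) @^-1` N).
      by rewrite -[X in measurable X]setTI; exact: measurable_tnth.
    apply/seteqP; split=> x /= => [/(_ i)|Nx j]; rewrite /A ?eqxx//.
    by case: eqP => [->|].
  - rewrite lebesgue_tuple_box; last by move=> j; rewrite /A; case: ifP.
    by rewrite (bigD1 i)//= /A eqxx; rewrite N0 mul0e.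
  - by move=> x nP j; rewrite /A; case: eqP => // ->; exact: PN.
exact: filter_forall.
Qed.

Lemma measurable_cube n (D : set RT) :
  measurable D -> measurable (cube (n := n) D).
Proof.
move=> mD; rewrite (_ : cube D = \bigcap_(i in [set: 'I_n])
    ((fun x : n.-tuple RT => tnth x i) @^-1` D)).
  apply: fin_bigcap_measurable => // i _.
  by rewrite -[X in measurable X]setTI; exact: measurable_tnth.
by apply/seteqP; split=> x /= + i => /(_ i); [|exact].
Qed.

(** Each [f i] is only almost everywhere equal on [D] to an integrable [g i]. Replacing it by [g i]
    cut off to 0 outside [D] reduces the claim to integrals over the whole space. *)
Lemma Rintegral_cube_tensor n (D : set RT) (f : 'I_n -> RT -> R)
    (G : n.-tuple RT -> R) :
  measurable D -> (forall i, lebesgue_integrable_on lambda D (f i)) ->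
  (forall x, cube D x -> G x = \prod_(i < n) f i (tnth x i)) ->
  \int[lebesgue_tuple R n]_(x in cube D) G x =
  \prod_(i < n) \int[lambda]_(x in D) f i x.
Proof.
move=> mD fi GE; pose g i := sval (cid2 (fi i)).
have gi i : lambda.-integrable D (EFin \o g i) by rewrite /g; case: cid2.
have fg i : {ae lambda, forall x, D x -> f i x = g i x}.
  by rewrite /g; case: cid2.
have gDi i : lambda.-integrable setT (EFin \o (g i \_ D)).
  by rewrite -restrict_EFin -integrable_mkcond.
transitivity (\int[lebesgue_tuple R n]_(x in cube D)
    \prod_(i < n) (g i \_ D) (tnth x i)).
  apply: Rintegral_ae_eq.
  have := lebesgue_tuple_ae fg; apply: filterS => x fgx Dx.
  rewrite GE//; apply: eq_bigr => i _.
  by rewrite patchE mem_set ?fgx//; exact: Dx.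
rewrite Rintegral_mkcond.
rewrite (_ : _ \_ _ = fun x => \prod_(i < n) (g i \_ D) (tnth x i)).
  rewrite (lebesgue_tuple_tensor gDi).2; apply: eq_bigr => i _.
  by rewrite -Rintegral_mkcond; apply/esym/Rintegral_ae_eq/fg.
(* Off the cube some coordinate leaves [D], and its cut-off factor kills the product. *)
apply/funext => x; rewrite patchE; case: ifPn => // /negP.
rewrite inE /cube /= => /existsNP[i Dxi].
by rewrite (bigD1 i)//= patchE memNset ?mul0r.
Qed.

End lebesgue_tensor.

(** * Worst-case errors and complexity in a single space *)

Section integration_problem.
Context d (T : measurableType d) (R : realType).
Context (mu : {measure set T -> \bar R}) (D : set T).
Hypothesis mD : measurable D.
Variable F : integrable_space mu D.
Implicit Types (f h : F).

Lemma fun_of0 x : D x -> fun_of (0 : F) x = 0.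
Proof.
move=> Dx; have := fun_of_linear 1 (0 : F) 0 Dx.
rewrite scaler0 addr0 mul1r => /eqP.
by rewrite -subr_eq0 opprD addNKr oppr_eq0 => /eqP.
Qed.

Lemma fun_ofZ (c : R) f x : D x -> fun_of (c *: f) x = c * fun_of f x.
Proof.
by move=> Dx; rewrite -[c *: f]addr0 fun_of_linear// fun_of0// addr0.
Qed.

Lemma integZ (c : R) f : integ (c *: f) = c * integ f.
Proof.
have [g gi fg] := fun_of_integrable f.
rewrite /integ (Rintegral_ae_eq fg) -RintegralZl//.
by apply: Rintegral_ae_eq; apply: filterS fg => x + Dx => <-//; rewrite fun_ofZ.
Qed.

Section quadrature_error.
Variables (N : nat) (a : 'I_N -> R) (x : 'I_N -> T).
Hypothesis Dx : forall k, D (x k).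

Lemma quadratureZ (c : R) f : quadrature a x (c *: f) = c * quadrature a x f.
Proof.
rewrite /quadrature mulr_sumr; apply: eq_bigr => k _.
by rewrite fun_ofZ// mulrCA.
Qed.

(** By homogeneity: a nonzero [f] is scaled onto the unit sphere, and for [f = 0] both sides
    vanish. *)
Lemma quadrature_error_le (e : R) f : (worst_case_error F a x <= e%:E)%E ->
  `|integ f - quadrature a x f| <= e * `|f|.
Proof.
move=> ee; have [->|f0] := eqVneq f 0.
  have := quadratureZ 0 0; have := integZ 0 (0 : F).
  by rewrite scale0r !mul0r => -> ->; rewrite subrr !normr0 mulr0.
have nf : 0 < `|f| by rewrite normr_gt0.
have : (`|integ (`|f|^-1 *: f) - quadrature a x (`|f|^-1 *: f)|%:E <= e%:E)%E.
  apply: le_trans ee; apply: ereal_sup_ubound; eexists; [|reflexivity].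
  by rewrite /unit_ball /= normrZ normfV normr_id mulVf ?gt_eqF.
rewrite lee_fin integZ quadratureZ -mulrBr normrM normfV normr_id.
by rewrite ler_pdivrMl// mulrC.
Qed.

Lemma pos_quadrature_error_ge (e A B : R) h (s : 'I_N -> F) :
  (forall k, 0 <= a k) -> (worst_case_error F a x <= e%:E)%E -> 0 <= e ->
  (forall k y, D y -> 0 <= fun_of (s k) y) ->
  (forall k, fun_of (s k) (x k) = fun_of h (x k)) ->
  (forall k, `|s k| <= A) -> (forall k, integ (s k) <= B) ->
  integ h - e * `|h| <= N%:R * (B + e * A).
Proof.
move=> a0 ee e0 s0 sh sA sB; apply: (@le_trans _ _ (quadrature a x h)).
  have := quadrature_error_le h ee; rewrite ler_norml => /andP[_]; lra.
apply: (@le_trans _ _ (\sum_(k < N) quadrature a x (s k))).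
  (* The [k]-th node alone gives [a k] times the value of [h] at [x k]; the other nodes contribute
     nonnegative terms. *)
  apply: ler_sum => k _; rewrite /quadrature (bigD1 k)//= sh lerDl.
  by apply: sumr_ge0 => j _; rewrite mulr_ge0// s0.
rewrite mulr_natl -[X in _ *+ X]card_ord -sumr_const; apply: ler_sum => k _.
have := quadrature_error_le (s k) ee; rewrite ler_norml => /andP[+ _].
have := ler_wpM2l e0 (sA k); have := sB k; lra.
Qed.

End quadrature_error.

(** To be applied in [F d] with the [d]-th powers of [alpha], [beta] and the constant. The
    conditions on [c] are products rather than quotients, so that [B = 0] is allowed. *)
Lemma complexity_pos_ge h (A B c eps : R) :
  is_worst_case h -> 0 < `|h| -> 0 < integ h ->
  (forall y, D y -> exists s : F, [/\ forall x, D x -> 0 <= fun_of s x,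
     fun_of s y = fun_of h y, `|s| <= A & integ s <= B]) ->
  0 <= c -> c * A <= `|h| -> c * B <= integ h -> 0 < eps < 1 / 2 ->
  ((c * (1 - 2 * eps))%:E <= complexity_pos F eps)%E.
Proof.
move=> hw h0 I0 hs c0 cA cB /andP[eps0 eps2].
apply/ereal_infP => _ [N [_ Ne] <-]; rewrite lee_fin.
(* [(1 - eps') / (1 + eps') = 1 - 2 eps], and [eps < eps'] makes up for the
   infimum in [min_error_pos] not being attained *)
pose eps' := eps / (1 - eps).
have e1 : 0 < 1 - eps by lra.
have eps'E : eps' * (1 - eps) = eps by rewrite mulfVK// gt_eqF.
have eps'0 : 0 < eps' by rewrite divr_gt0.
(* The second factor is the initial error, since [h] is a worst-case function. *)
pose e := eps' * (`|h|^-1 * integ h).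
have lt_min : (min_error_pos F N < e%:E)%E.
  apply: le_lt_trans Ne _; rewrite hw integZ -EFinM lte_fin.
  rewrite ltr_pM2r ?mulr_gt0 ?invr_gt0//; nra.
have [_ [a [x [a0 Dx ->]]] /ltW lt_e] := ereal_inf_lt lt_min.
pose s k := sval (cid (hs (x k) (Dx k))).
have sP k := svalP (cid (hs (x k) (Dx k))).
have e0 : 0 <= e by rewrite !mulr_ge0 ?invr_ge0// ltW.
have hN : integ h - e * `|h| <= N%:R * (B + e * A).
  by apply: (pos_quadrature_error_ge Dx a0 lt_e e0 (s := s)) => k;
    case: (sP k).
have eh : e * `|h| = eps' * integ h.
  by rewrite /e [_^-1 * _]mulrC -!mulrA mulVf ?mulr1// gt_eqF.
have ceA : e * (c * A) <= eps' * integ h by rewrite -eh ler_wpM2l.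
(* Multiplying [hN] by [c] lets [c * A] and [c * B] be replaced by the norm and the integral of [h];
   the positive common factor [integ h] can then be cancelled. *)
have : c * (integ h - eps' * integ h) <= N%:R * (integ h + eps' * integ h).
  apply: (@le_trans _ _ (N%:R * (c * B + e * (c * A)))).
    by move: (ler_wpM2l c0 hN); rewrite eh; nra.
  by rewrite ler_wpM2l// lerD.
have -> : integ h - eps' * integ h = (1 - eps') * integ h by lra.
have -> : integ h + eps' * integ h = (1 + eps') * integ h by lra.
rewrite !mulrA.
rewrite ler_pM2r// => /(ler_wpM2r (ltW e1)).
have -> : c * (1 - eps') * (1 - eps) = c * (1 - 2 * eps).
  by rewrite -mulrA mulrBl eps'E; congr (_ * _); lra.
suff -> : N%:R * (1 + eps') * (1 - eps) = N%:R by [].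
by rewrite -mulrA mulrDl eps'E mul1r subrK mulr1.
Qed.

End integration_problem.

(** * The lower bound for tensor powers and the curse *)

Theorem theorem4 (R : realType) (D1 : set (measurableTypeR R))
    (mD1 : measurable D1)
    (F1 : integrable_space (@lebesgue_measure R) D1)
    (F : forall d : nat, integrable_space (@lebesgue_tuple R d) (cube (n := d) D1))
    (tensorF : forall d, (0 < d)%N -> is_tensor_power F1 (F d))
    (h1 : F1) (worst_h1 : is_worst_case h1)
    (worst_hd : forall d, (0 < d)%N -> forall hd : F d,
       is_elementary_tensor (fun=> h1) hd -> is_worst_case hd)
    (s : R -> F1)
    (s_ge0 : forall y, D1 y -> forall x, D1 x -> 0 <= fun_of (s y) x)
    (s_diag : forall y, D1 y -> fun_of (s y) y = fun_of h1 y)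
    (alpha beta : R)
    (alpha_max : is_maximum [set `|s y| | y in D1] alpha)
    (alpha_lt : alpha < `|h1|)
    (beta_max : is_maximum [set integ (s y) | y in D1] beta)
    (beta_lt : beta < integ h1) :
  let C : \bar R :=
    (mine (`|h1|%:E / alpha%:E) ((integ h1)%:E / beta%:E))%E in
  [/\ (1 < C)%E,
      forall (eps : R) (d : nat), 0 < eps < 1 / 2 -> (0 < d)%N ->
        (C ^+ d * (1 - 2 * eps)%:E <= complexity_pos (F d) eps)%E &
      curse_of_dimensionality (fun eps d => complexity_pos (F d) eps)].
Proof.
move=> C.
have [[y0 Dy0 _] alphaP] := alpha_max.
have [[y1 Dy1 beta1] betaP] := beta_max.
(* If [alpha] were 0, every [s y] would vanish, hence so would [h1] on the diagonal condition,
   contradicting [alpha_lt]. *)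
have alpha0 : 0 < alpha.
  have alpha_ge0 : 0 <= alpha.
    by rewrite (le_trans (normr_ge0 (s y0)))// alphaP//; exists y0.
  rewrite lt_neqAle alpha_ge0 andbT eq_sym; apply/eqP => a0.
  move: alpha_lt; rewrite a0 ltNge => /negP; apply.
  suff -> : h1 = 0 by rewrite normr0.
  apply: fun_of_inj => x Dx; rewrite fun_of0// -s_diag//.
  have : `|s x| <= 0 by rewrite -a0 alphaP//; exists x.
  by rewrite normr_le0 => /eqP ->; rewrite fun_of0.
have beta0 : 0 <= beta by rewrite -beta1; apply: Rintegral_ge0; exact: s_ge0.
have h0 : 0 < `|h1| := lt_trans alpha0 alpha_lt.
have I0 : 0 < integ h1 := le_lt_trans beta0 beta_lt.
(* Since [alpha] is positive, [C] is finite even when [beta] is 0; in that case the second quotient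
   is infinite and the first one is the minimum. *)
have [c [CE c1 calpha cbeta]] : exists c : R, [/\ C = c%:E, 1 < c,
    c * alpha <= `|h1| & c * beta <= integ h1].
  rewrite /C inver gt_eqF// -EFinM.
  have c1 : 1 < `|h1| / alpha by rewrite ltr_pdivlMr// mul1r.
  rewrite inver; case: eqVneq => [->|b0].
    rewrite gt0_muley ?lte_fin// miney; exists (`|h1| / alpha).
    by split; rewrite ?mulr0 ?divfK ?gt_eqF // ltW.
  have {b0}beta0 : 0 < beta by rewrite lt_neqAle eq_sym b0.
  rewrite -EFinM -EFin_min; eexists; split; first reflexivity.
  - by rewrite lt_min c1 ltr_pdivlMr// mul1r.
  - by rewrite -ler_pdivlMr// ge_min lexx.
  - by rewrite -ler_pdivlMr// ge_min lexx orbT.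
have lb (eps : R) d : 0 < eps < 1 / 2 -> (0 < d)%N ->
    (C ^+ d * (1 - 2 * eps)%:E <= complexity_pos (F d) eps)%E.
  move=> eps01 d0; rewrite CE -EFin_expe -EFinM.
  have [tens _] := tensorF d d0; have [hd hdE nhd] := tens (fun=> h1).
  have mDd : measurable (cube (n := d) D1).
    exact: measurable_cube.
  have integE (f : 'I_d -> F1) (g : F d) : is_elementary_tensor f g ->
      integ g = \prod_(i < d) integ (f i).
    move=> fg; apply: Rintegral_cube_tensor => // i; exact: fun_of_integrable.
  have c0 : 0 <= c by rewrite ltW// (lt_trans ltr01).
  have Ihd : integ hd = integ h1 ^+ d.
    by rewrite (integE _ _ hdE) prodr_const card_ord.
  have {}nhd : `|hd| = `|h1| ^+ d by rewrite nhd prodr_const card_ord.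
  apply: (@complexity_pos_ge _ _ _ _ _ mDd (F d) hd (alpha ^+ d) (beta ^+ d)).
  - exact: worst_hd.
  - by rewrite nhd exprn_gt0.
  - by rewrite Ihd exprn_gt0.
  (* The function attached to a node is the tensor product of the [s] at its coordinates; the
     crossnorm and Fubini turn the univariate bounds into powers. *)
  - move=> y Dy; have [sy syE nsy] := tens (fun i => s (tnth y i)).
    exists sy; split.
    + by move=> x Dx; rewrite syE// prodr_ge0// => i _; apply: s_ge0.
    + by rewrite syE// hdE//; apply: eq_bigr => i _; exact: s_diag.
    + rewrite nsy -[X in _ ^+ X]card_ord -prodr_const ler_prod// => i _.
      by rewrite normr_ge0/= alphaP//; exists (tnth y i).
    + rewrite (integE _ _ syE) -[X in _ ^+ X]card_ord -prodr_const.
      rewrite ler_prod// => i _.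
      rewrite betaP ?andbT; last by exists (tnth y i).
      by apply: Rintegral_ge0; exact: s_ge0.
  - exact: exprn_ge0.
  - by rewrite nhd -exprMn lerXn2r// nnegrE ?mulr_ge0 ?(ltW alpha0) ?(ltW I0).
  - by rewrite Ihd -exprMn lerXn2r// nnegrE ?mulr_ge0 ?(ltW alpha0) ?(ltW I0).
  - exact: eps01.
split; [by rewrite CE lte_fin|exact: lb|].
(* With error level 1/4 the factor [1 - 2 * eps] is 1/2, which serves as the constant in front of
   [c ^+ d]. *)
exists (1 / 4); first by lra.
exists (1 / 2), c; split; [by lra|exact: c1|move=> d d0].
apply: le_trans (lb (1 / 4) d _ d0); last by lra.
rewrite CE -EFin_expe -EFinM lee_fin mulrC ler_wpM2l ?exprn_ge0//; last by lra.
by rewrite ltW// (lt_trans ltr01).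
Qed.
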